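(* Let $D$ be a digraph in $D(1,1)$ with $m$ edges, and let $t$ be the maximum number of pairwise vertex-disjoint directed triangles in $D$. Then $D$ has a directed cut of size at least $(2m-t)/5$.
   Context: All digraphs are finite, without loops and without parallel edges (an edge $xy$ goes from tail $x$ to head $y$; $xy$ and $yx$ may both be present). For integers $k,\ell\ge 0$, $D(k,\ell)$ denotes the family of digraphs in which every vertex $v$ satisfies $d^-(v)\le k$ or $d^+(v)\le \ell$ (indegree at most $k$ or outdegree at most $\ell$). A directed cut of a digraph $D$ is a set of edges of the form $\{xy\in E(D): x\in X, y\in Y\}$ for some partition $X,Y$ of $V(D)$; its size is its cardinality. A directed triangle is a directed cycle of length 3. *)

(* Defs.v *)
From mathcomp Require Import all_boot all_order all_algebra.

Set Implicit Arguments.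
Unset Strict Implicit.
Unset Printing Implicit Defensive.

(* A finite digraph without loops or parallel edges is a finType V with an
   irreflexive e : rel V; [e x y] means that xy is an edge with tail x and
   head y, and e x y and e y x may both hold. *)

Definition edges (V : finType) (e : rel V) : {set V * V} :=
  [set xy | e xy.1 xy.2].

Definition indeg (V : finType) (e : rel V) (v : V) : nat := #|[set x | e x v]|.

Definition outdeg (V : finType) (e : rel V) (v : V) : nat := #|[set y | e v y]|.

Definition in_D (k l : nat) (V : finType) (e : rel V) : Prop :=
  forall v : V, indeg e v <= k \/ outdeg e v <= l.

(* The two sides of the partition may be empty (a one-vertex digraph must have
   a directed cut). *)
Definition directed_cut (V : finType) (e : rel V) (C : {set V * V}) : Prop :=
  exists X Y : {set V},
    [/\ X :|: Y = [set: V], [disjoint X & Y]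
      & C = [set xy in edges e | (xy.1 \in X) && (xy.2 \in Y)]].

(* A triangle is recorded as a cyclic sequence (x, y, z) with a chosen start. *)
Definition directed_triangle (V : finType) (e : rel V) (T : 3.-tuple V) : bool :=
  cycle e T && uniq T.

(* The rotations of one triangle share vertices, so a packing contains at most
   one of them and its cardinality does count triangles. *)
Definition triangle_packing (V : finType) (e : rel V)
    (F : {set 3.-tuple V}) : bool :=
  [forall T in F, directed_triangle e T] &&
  [forall T in F, forall T' in F, (T != T') ==> [disjoint T & T']].

Definition max_disjoint_triangles (V : finType) (e : rel V) : nat :=
  \max_(F : {set 3.-tuple V} | triangle_packing e F) #|F|.

(* Main.v *)
(* Call two edges consecutive if the head of one is the tail of the other. The
   tails of pairwise non-consecutive edges, against all other vertices, give a
   directed cut containing these edges; so what is needed is a large independent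
   set in the graph L of consecutiveness. By induction it suffices to find an
   independent J with 2 |N[J]| <= 5 |J|, or a vertex of degree 2 in a triangle of
   L, which is a directed triangle disjoint from those left after its removal.
   Suppose L has neither. Then all degrees are at least 2, and no two vertices of
   degree 2 have a common neighbour. Let A be the set of vertices of D of
   indegree at most 1. The edges from A to its complement are independent and of
   degree 2 in L, while the remaining part H of L has an orientation of outdegree
   at most 1. Double counting then makes all the estimates tight: each vertex of
   H has exactly one neighbour of degree 2, and degree 3 unless its own degree
   is 2. In the resulting explicit configurations a set J as above exists. *)
Require Import Defs.
From mathcomp Require Import all_boot all_order all_algebra.
From mathcomp Require Import zify.
Import Order.TTheory GRing.Theory Num.Theory.

Set Implicit Arguments.
Unset Strict Implicit.
Unset Printing Implicit Defensive.

(** * Closed neighbourhoods and irreducible sets *)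

Section Neighbourhoods.

Variables (T : finType) (adj : rel T).

Definition nbr (S : {set T}) (f : T) : {set T} := [set g in S | adj f g].

Definition cnbr (S J : {set T}) : {set T} := J :|: \bigcup_(f in J) nbr S f.

Definition independent (J : {set T}) : bool :=
  [forall f in J, forall g in J, ~~ adj f g].

Lemma independentP (J : {set T}) :
  reflect {in J &, forall f g, ~~ adj f g} (independent J).
Proof.
apply: (iffP forall_inP) => [indJ f g fJ gJ|indJ f fJ].
  by move/forall_inP: (indJ _ fJ) => /(_ _ gJ).
by apply/forall_inP => g gJ; apply: indJ.
Qed.

(** Neither reduction applies: the first deletes [cnbr S J] at no cost in triangles, the second
    deletes a vertex of degree 2 with its neighbours at the cost of one triangle. *)
Definition irreducible (S : {set T}) : Prop :=
  (forall J : {set T}, J \subset S -> independent J -> J != set0 ->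
     5 * #|J| < 2 * #|cnbr S J|) /\
  (forall f g h, f \in S -> #|nbr S f| = 2 -> g \in nbr S f -> h \in nbr S f ->
     ~~ adj g h).

Lemma nbrP (S : {set T}) (f g : T) :
  reflect (g \in S /\ adj f g) (g \in nbr S f).
Proof. by rewrite inE; apply: andP. Qed.

Lemma cnbr_subset (S J B : {set T}) :
  J \subset B -> {in J, forall f, nbr S f \subset B} -> cnbr S J \subset B.
Proof. by move=> JB nB; rewrite subUset JB /=; apply/bigcupsP. Qed.

End Neighbourhoods.

(** * Counting in finite sets *)

Lemma eq_sum_leq (T : finType) (A : {set T}) (F G : T -> nat) :
  {in A, forall i, F i <= G i} -> \sum_(i in A) G i <= \sum_(i in A) F i ->
  {in A, forall i, F i = G i}.
Proof.
move=> leFG leGF i iA.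
have leif j : j \in A -> F j <= G j ?= iff (F j == G j) by move/leFG/leqif_eq.
have [leS eqS] := leqif_sum leif.
have := eqn_leq (\sum_(i in A) F i) (\sum_(i in A) G i).
by rewrite eqS leS leGF => /forall_inP/(_ i iA)/eqP.
Qed.

Lemma sum_card_exchange (T : finType) (A : {set T}) (R : rel T) :
  \sum_(x in A) #|[set y in A | R x y]| = \sum_(x in A) #|[set y in A | R y x]|.
Proof.
have cardE (Q : pred T) : #|[set y in A | Q y]| = \sum_(y in A) (Q y : nat).
  by rewrite -sum1dep_card big_mkcondr; apply: eq_bigr => y _; case: (Q y).
under eq_bigr do rewrite cardE.
by rewrite exchange_big; apply: eq_bigr => x _; rewrite cardE.
Qed.

Lemma card_le3 (T : finType) (a b c : T) : #|[set a; b; c]| <= 3.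
Proof.
apply: leq_trans (leq_card_setU _ _) _; rewrite cards1 cards2.
by case: (a != b).
Qed.

Lemma leq_card_bigcup (I T : finType) (A : {set I}) (F : I -> {set T}) :
  #|\bigcup_(i in A) F i| <= \sum_(i in A) #|F i|.
Proof.
elim/big_rec2: _ => [|i m B _ le]; first by rewrite cards0.
by apply: leq_trans (leq_card_setU _ _) _; rewrite leq_add2l.
Qed.

Lemma card_setD1 (T : finType) (A : {set T}) (x : T) :
  x \in A -> #|A :\ x| = #|A|.-1.
Proof. by move=> xA; rewrite (cardsD1 x A) xA. Qed.

Lemma card1_eq (T : finType) (A : {set T}) (x y : T) :
  #|A| = 1 -> x \in A -> y \in A -> x = y.
Proof. by move/eqP/cards1P => [z ->] /set1P-> /set1P->. Qed.

(** * Irreducible sets in an abstract graph *)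

Section Irreducible.

Variables (T : finType) (adj : rel T) (S I : {set T}).
(* [parent] orients the graph induced on [H], at most one edge out of each vertex. *)
Variables (parent : T -> {set T}) (side : T -> bool).
Local Notation N := (nbr adj S).
Local Notation H := (S :\: I).
Hypothesis adj_sym : symmetric adj.
Hypothesis adj_irr : {in S, forall f, ~~ adj f f}.
Hypothesis I_sub : I \subset S.
Hypothesis I_independent : {in I &, forall f g, ~~ adj f g}.
Hypothesis I_deg : {in I, forall f, #|N f| <= 2}.
Hypothesis parent_sub : forall f, parent f \subset H.
Hypothesis card_parent : {in H, forall f, #|parent f| <= 1}.
Hypothesis adj_parent : {in H &, forall f g, adj f g ->
  (g \in parent f) || (f \in parent g)}.
(** In the application [side] tells whether the tail of an edge lies in [A]. It is constant along
    the edges of [H] and separates the neighbours of a vertex of [I], provided that the vertices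
    concerned have a parent. *)
Hypothesis adj_side : {in H &, forall f g, #|parent f| = 1 -> #|parent g| = 1 ->
  adj f g -> side f = side g}.
Hypothesis side_inj : forall v, v \in I ->
  {in N v &, forall f g, #|parent f| = 1 -> #|parent g| = 1 ->
   side f = side g -> f = g}.
Hypothesis irred : irreducible adj S.

Let reduce := irred.1.
Let no_triangle := irred.2.

Lemma reduce_bound (J B : {set T}) :
  J \subset S -> independent adj J -> J != set0 -> J \subset B ->
  {in J, forall f, N f \subset B} -> 5 * #|J| < 2 * #|B|.
Proof.
move=> JS indJ J0 JB NB; apply: leq_trans (reduce JS indJ J0) _.
by rewrite leq_mul2l subset_leq_card //; apply: cnbr_subset.
Qed.

Lemma card_nbr_ge2 f : f \in S -> 2 <= #|N f|.
Proof.
move=> fS; have := @reduce_bound [set f] (f |: N f).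
rewrite sub1set subsetUl cards1 => red.
have [le _] := leq_card_setU [set f] (N f); rewrite cards1 in le.
suff: 5 < 2 * #|f |: N f| by move: le; clear; lia.
apply: red => //.
- by apply/independentP => g h /set1P-> /set1P->; apply: adj_irr.
- by apply/set0Pn; exists f; rewrite inE.
- by move=> g /set1P->; apply: subsetUr.
Qed.

Lemma I_deg2 f : f \in I -> #|N f| = 2.
Proof.
move=> fI; have fS : f \in S by apply: (subsetP I_sub).
by apply/eqP; rewrite eqn_leq I_deg // card_nbr_ge2.
Qed.

Definition nbr2 (f : T) : {set T} := [set g in N f | #|N g| == 2].

Lemma nbr2P f g : reflect [/\ g \in S, adj f g & #|N g| = 2] (g \in nbr2 f).
Proof.
rewrite !inE; apply: (iffP andP) => [[/andP[? ?] /eqP]|[? ?] /eqP] //.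
by move=> ?; split=> //; apply/andP.
Qed.

(** Two such neighbours [f], [g] are not adjacent, by the absence of triangles at vertices of degree
    2. As they share [h], the closed neighbourhood of [[set f; g]] has at most 5 elements, and 2 * 5
    is not above 5 * 2. *)
Lemma card_nbr2 h : h \in S -> #|nbr2 h| <= 1.
Proof.
move=> hS; apply/card_le1_eqP => g f /nbr2P[gS hg g2] /nbr2P[fS hf f2].
apply/eqP/contraT => fg.
have hNg : h \in N g by apply/nbrP; rewrite adj_sym.
have hNf : h \in N f by apply/nbrP; rewrite adj_sym.
have afg : ~~ adj f g.
  apply/negP => afg.
  have gNf : g \in N f by apply/nbrP.
  by have := no_triangle fS f2 hNf gNf; rewrite hg.
pose B := [set f; g] :|: (N f :|: N g :\ h).
have [le1 _] := leq_card_setU [set f; g] (N f :|: N g :\ h).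
have [le2 _] := leq_card_setU (N f) (N g :\ h).
have := cardsD1 h (N g); rewrite hNg g2 f2 in le2 * => le3.
rewrite cards2 fg in le1.
have := @reduce_bound [set f; g] B; rewrite cards2 fg => red.
suff: 10 < 2 * #|B| by rewrite /B; move: le1 le2 le3; clear; lia.
apply: red; last 2 first.
- exact: subsetUl.
- move=> k /set2P[]->; apply/subsetP => x xN; rewrite !in_setU ?xN ?orbT //.
  rewrite in_setD1 xN andbT; case: eqP => [->|_]; last by rewrite !orbT.
  by rewrite hNf !orbT.
- by apply/subsetP => x /set2P[]->.
- apply/independentP => x y /set2P[]-> /set2P[]-> //; try exact: adj_irr.
  by rewrite adj_sym.
- by apply/set0Pn; exists f; rewrite !inE eqxx.
Qed.

(** * Double counting over [H] *)

Definition nbr_in (B : {set T}) (f : T) : {set T} := [set g in B | adj f g].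
Local Notation NI := (nbr_in I).
Local Notation NH := (nbr_in H).
Definition nbrH2 (f : T) : {set T} := [set g in H | adj f g && (#|N g| == 2)].

Lemma card_nbr f : #|N f| = #|NI f| + #|NH f|.
Proof.
rewrite -(cardsID I (N f)); congr (_ + _); apply: eq_card => g; rewrite !inE.
  by case gI: (g \in I); rewrite ?andbF // (subsetP I_sub) //= andbT.
by rewrite andbA.
Qed.

Lemma nbr2E f : nbr2 f = NI f :|: nbrH2 f.
Proof.
apply/setP => g; rewrite !inE; case gI: (g \in I) => /=.
  by rewrite I_deg2 // (subsetP I_sub) //= andbT orbF.
by rewrite andbA.
Qed.

Lemma card_nbr2E f : #|nbr2 f| = #|NI f| + #|nbrH2 f|.
Proof.
rewrite nbr2E -(cardsID I (_ :|: _)); congr (_ + _); apply: eq_card => g.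
  by rewrite !inE; case: (g \in I); rewrite ?andbF //= andbT orbF.
by rewrite !inE; case: (g \in I).
Qed.

Definition children (f : T) : {set T} := [set g in H | f \in parent g].

Lemma sum_children : \sum_(f in H) #|children f| = \sum_(f in H) #|parent f|.
Proof.
rewrite /children -(sum_card_exchange _ (fun f g => g \in parent f)).
apply: eq_bigr => f _; apply: eq_card => g; rewrite [LHS]inE.
by apply: andb_idl; apply: (subsetP (parent_sub f)).
Qed.

Lemma card_NH f : f \in H -> #|NH f| <= #|parent f| + #|children f|.
Proof.
move=> fH; have [le _] := leq_card_setU (parent f) (children f).
apply: leq_trans le; apply/subset_leq_card/subsetP => g.
rewrite [_ \in NH f]inE => /andP[gH fg].
by rewrite in_setU [_ \in children f]inE gH adj_parent.
Qed.

(** Both sides count the adjacent pairs in [H] with one marked end of degree 2, by the other end and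
    by the marked one. *)
Lemma sum_nbrH2 :
  \sum_(f in H) #|nbrH2 f| = \sum_(f in H) (#|N f| == 2) * #|NH f|.
Proof.
rewrite /nbrH2 (sum_card_exchange _ (fun f g => adj f g && (#|N g| == 2))).
apply: eq_bigr => f _; case: (#|N f| == 2); rewrite ?mul1n ?mul0n.
  by apply: eq_card => g; rewrite !inE andbT adj_sym.
by apply: eq_card0 => g; rewrite !inE andbF andbF.
Qed.

(* Summed over [H],
     3 <= |NI| + |NH| + [deg = 2] <= |NI| + |NH| + [deg = 2] |NH|
       = |NI| + |nbrH2| + |NH| <= 1 + 2 |parent| <= 3,
   so every pointwise estimate used in this chain is an equality. *)
Lemma degree_structure f : f \in H ->
  [/\ #|parent f| = 1, #|NI f| + #|nbrH2 f| = 1, #|N f| + (#|N f| == 2) = 3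
    & #|N f| = 2 -> #|NH f| = 1].
Proof.
have HS g : g \in H -> g \in S by rewrite inE => /andP[].
pose s (F : T -> nat) := \sum_(g in H) F g.
pose D2 g : nat := #|N g| == 2.
have ea : {in H, forall g, 3 <= #|NI g| + #|NH g| + D2 g}.
  move=> g gH; rewrite -card_nbr /D2.
  by have := card_nbr_ge2 (HS _ gH); case: eqP => /=; clear; lia.
have ec : {in H, forall g, #|NI g| + #|nbrH2 g| <= 1}.
  by move=> g gH; rewrite -card_nbr2E card_nbr2 ?HS.
(* A vertex of degree 2 has at most one neighbour in [I] by [ec], hence at least one in [H]. *)
have eb : {in H, forall g, D2 g <= D2 g * #|NH g|}.
  move=> g gH; rewrite /D2; case: eqP => // g2; rewrite mul1n.
  by have := ea _ gH; have := ec _ gH; rewrite /D2 g2; clear; lia.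
have Sa : s (fun=> 3) <= s (fun g => #|NI g| + #|NH g| + D2 g) by apply: leq_sum.
have Sb : s D2 <= s (fun g => D2 g * #|NH g|) by apply: leq_sum.
have Sc : s (fun g => #|NI g| + #|nbrH2 g|) <= s (fun=> 1) by apply: leq_sum.
have Sd : s (fun g => #|NH g|) <= s (fun g => #|parent g| + #|children g|).
  by apply: leq_sum => g; apply: card_NH.
have Se : s (fun g => #|parent g|) <= s (fun=> 1) by apply: leq_sum.
have sD F G : s (fun g => F g + G g) = s F + s G by apply: big_split.
have s3 : s (fun=> 3) = s (fun=> 1) + s (fun=> 1) + s (fun=> 1) by rewrite -!sD.
have sch : s (fun g => #|children g|) = s (fun g => #|parent g|) := sum_children.
have sH2 : s (fun g => #|nbrH2 g|) = s (fun g => D2 g * #|NH g|) := sum_nbrH2.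
have sDa : s (fun g => #|NI g| + #|NH g| + D2 g) =
    s (fun g => #|NI g|) + s (fun g => #|NH g|) + s D2 by rewrite !sD.
rewrite sDa s3 in Sa; rewrite sD in Sc; rewrite sD sch in Sd.
move=> fH; split.
- apply: (eq_sum_leq card_parent) fH; rewrite -!/(s _).
  by move: Sa Sb Sc Sd Se sH2; clear; lia.
- apply: (eq_sum_leq ec) fH; rewrite -!/(s _) sD.
  by move: Sa Sb Sc Sd Se sH2; clear; lia.
- rewrite {1}card_nbr; apply/esym.
  apply: (eq_sum_leq ea) fH; rewrite -!/(s _) sDa s3.
  by move: Sa Sb Sc Sd Se sH2; clear; lia.
- have Eb : s (fun g => D2 g * #|NH g|) <= s D2.
    by move: Sa Sb Sc Sd Se sH2; clear; lia.
  by move=> f2; have := eq_sum_leq eb Eb fH; rewrite /D2 f2 mul1n => <-.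
Qed.

(** * Explicit configurations in an irreducible set *)

Lemma N_in f g : g \in N f = (g \in S) && adj f g.
Proof. by rewrite inE. Qed.

Lemma H_sub f : f \in H -> f \in S.
Proof. by rewrite inE => /andP[]. Qed.

Lemma H_or_I f : f \in S -> (f \in I) || (f \in H).
Proof. by move=> fS; rewrite in_setD fS andbT orbN. Qed.

Lemma nbr_I_sub v f : v \in I -> f \in N v -> f \in H.
Proof.
move=> vI /nbrP[fS vf]; have /orP[fI|//] := H_or_I fS.
by have := I_independent vI fI; rewrite vf.
Qed.

Lemma side_adj f g : f \in H -> g \in H -> adj f g -> side f = side g.
Proof.
by move=> fH gH; apply: adj_side => //; [case: (degree_structure fH) | case: (degree_structure gH)].
Qed.

Lemma side_nbr_inj v f g :
  v \in I -> f \in N v -> g \in N v -> side f = side g -> f = g.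
Proof.
move=> vI fv gv; apply: (side_inj vI) => //.
- by have [] := degree_structure (nbr_I_sub vI fv).
- by have [] := degree_structure (nbr_I_sub vI gv).
Qed.

Lemma nbr2_unique f g h : f \in H -> g \in nbr2 f -> h \in nbr2 f -> g = h.
Proof. by move=> fH; apply: card1_eq; rewrite card_nbr2E; case: (degree_structure fH). Qed.

Lemma exists_nbr2 f : f \in H -> exists z, z \in nbr2 f.
Proof.
by move=> fH; apply/card_gt0P; rewrite card_nbr2E; case: (degree_structure fH) => _ ->.
Qed.

Lemma card_nbr_H f : f \in H -> #|N f| != 2 -> #|N f| = 3.
Proof. by move=> fH; case: (degree_structure fH) => _ _; case: eqP => //=; clear; lia. Qed.

(** Such an [f] has one neighbour [g] in [H] and one neighbour [v] in [I]. As [f] is the only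
    neighbour of [g] of degree 2, the other two neighbours [u1], [u2] of [g] lie in [H] and have
    degree 3. Their neighbours [z1], [z2] of degree 2, together with [g] and [v], form a reducible
    set. *)
Lemma H_deg2_false f : f \in H -> #|N f| = 2 -> False.
Proof.
move=> fH f2; have [_ fI2 _ /(_ f2) fNH] := degree_structure fH; have fS := H_sub fH.
have [g gNH] : exists g, g \in NH f by apply/card_gt0P; rewrite fNH.
have [v vNI] : exists v, v \in NI f.
  by apply/card_gt0P; have := card_nbr f; rewrite f2 fNH; clear; lia.
have [gH fg] : g \in H /\ adj f g by move: gNH; rewrite inE => /andP[].
have [vI fv] : v \in I /\ adj f v by move: vNI; rewrite inE => /andP[].
have gS := H_sub gH; have vS := subsetP I_sub _ vI.
have NHf h : h \in H -> adj f h -> h = g.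
  by move=> hH fh; apply: card1_eq fNH _ gNH; rewrite inE hH.
have fH2 : f \in nbrH2 g by rewrite inE fH adj_sym fg f2.
have [_ gI2 _ gNH1] := degree_structure gH.
have gH2 : 0 < #|nbrH2 g| by apply/card_gt0P; exists f.
have gNI : #|NI g| = 0 by move: gI2 gH2; clear; lia.
have g2 : #|N g| != 2.
  by apply/eqP => g2; have := gNH1 g2; have := card_nbr g; rewrite g2 gNI; clear; lia.
have g3 := card_nbr_H gH g2.
have nbr2g h : h \in S -> adj g h -> #|N h| = 2 -> h = f.
  move=> hS gh h2; apply: (nbr2_unique gH); apply/nbr2P; split=> //.
  by rewrite adj_sym.
have fNg : f \in N g by rewrite N_in fS adj_sym.
have /cards2P[u1 [u2 [u12 EU]]] : #|N g :\ f| == 2.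
  by rewrite card_setD1 // g3.
have UP u : u \in N g :\ f -> [/\ u \in H, adj g u, u != f & #|N u| != 2].
  rewrite in_setD1 N_in => /and3P[uf uS gu]; split=> //.
    have /orP[uI|//] := H_or_I uS.
    by move: (card0_eq gNI u); rewrite !inE uI gu.
  by apply: contra uf => /eqP u2'; rewrite (nbr2g u).
(* [f], [g], [u1] and [u2] are on one side, so no vertex of [I] is adjacent to two of them. *)
have sideU u : u \in N g :\ f -> side u = side f.
  by case/UP => uH gu _ _; rewrite -(side_adj gH uH gu) (side_adj fH gH fg).
have ZP u z : u \in N g :\ f -> z \in nbr2 u ->
  [/\ z \in S, adj u z, #|N z| = 2 & [/\ z != v, z != g, ~~ adj g z & ~~ adj v z]].
  move=> uU /nbr2P[zS uz z2]; have [uH gu uf _] := UP _ uU.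
  have zf : z != f.
    apply/eqP => zf; move: uz; rewrite zf adj_sym => /(NHf _ uH) ug.
    by have := adj_irr gS; rewrite -{2}ug gu.
  split=> //; split.
  - apply: contra uf => /eqP zv; apply/eqP; apply: (side_nbr_inj vI).
    + by rewrite N_in (H_sub uH) adj_sym -zv.
    + by rewrite N_in fS adj_sym.
    + exact: sideU.
  - by apply: contra g2 => /eqP <-; rewrite z2.
  - by apply: contra zf => gz; rewrite (nbr2g z).
  - have /orP[zI|zH] := H_or_I zS; first exact: I_independent.
    apply: contra zf => vz; apply/eqP; apply: (side_nbr_inj vI).
    + by rewrite N_in zS.
    + by rewrite N_in fS adj_sym.
    + by rewrite -(side_adj uH zH uz) sideU.
have u1U : u1 \in N g :\ f by rewrite EU set21.
have u2U : u2 \in N g :\ f by rewrite EU set22.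
have [u1H gu1 u1f u1n2] := UP _ u1U; have [u2H gu2 u2f u2n2] := UP _ u2U.
have [z1 z1N] := exists_nbr2 u1H; have [z2 z2N] := exists_nbr2 u2H.
have [z1S uz1 z1d [z1v z1g gz1 vz1]] := ZP _ _ u1U z1N.
have [z2S uz2 z2d [z2v z2g gz2 vz2]] := ZP _ _ u2U z2N.
(* Otherwise [z] and [u'] are neighbours of [z'] on the same side, hence equal, although only [z]
   has degree 2. *)
have mixed u z u' z' : u \in N g :\ f -> u' \in N g :\ f -> z \in nbr2 u ->
    z' \in nbr2 u' -> z \in H -> z' \in I -> ~~ adj z z'.
  move=> uU u'U zu zu' zH z'I; apply/negP => zz'.
  have [zS uz zd _] := ZP _ _ uU zu; have [_ uz' _ _] := ZP _ _ u'U zu'.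
  have [u'H _ _ u'd] := UP _ u'U; have [uH _ _ _] := UP _ uU.
  suff zE : z = u' by rewrite -zE zd in u'd.
  apply: (side_nbr_inj z'I); rewrite ?N_in ?zS ?(H_sub u'H) 1?adj_sym //.
  by rewrite -(side_adj uH zH uz) !sideU.
have z12 : z1 != z2.
  apply/eqP => E; move: u12; suff -> : u1 = u2 by rewrite eqxx.
  have /orP[zI|zH] := H_or_I z1S.
    apply: (side_nbr_inj zI); rewrite ?N_in ?(H_sub u1H) ?(H_sub u2H) 1?adj_sym //.
      by rewrite E.
    by rewrite !sideU.
  have [_ _ _ /(_ z1d) /card1_eq] := degree_structure zH; apply.
    by rewrite inE u1H adj_sym.
  by rewrite inE u2H adj_sym E.
have z12n : ~~ adj z1 z2.
  have /orP[z1I|z1H] := H_or_I z1S; have /orP[z2I|z2H] := H_or_I z2S.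
  - exact: I_independent.
  - by rewrite adj_sym; apply: mixed z2N z1N _ _.
  - by apply: mixed z1N z2N _ _.
  (* The only neighbour of [z1] in [H] is [u1], so [z2] would be [u1], which does not have degree
     2. *)
  - apply/negP => zz; suff E : u1 = z2 by rewrite E z2d in u1n2.
    have [_ _ _ /(_ z1d) /card1_eq] := degree_structure z1H; apply; last by rewrite inE z2H.
    by rewrite inE u1H adj_sym.
have gv : ~~ adj g v.
  by apply/negP => gv; move: (card0_eq gNI v); rewrite !inE vI gv.
have vg : v != g.
  by apply: contraTneq vI => ->; move: gH; rewrite inE => /andP[].
(* The 4 vertices of [J] have only 6 further neighbours: f, u1, u2 and the other
   neighbours of v, z1, z2. *)
pose J := [set g; v; z1; z2].
pose D := N v :\ f :|: (N z1 :\ u1) :|: (N z2 :\ u2).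
have J4 : #|J| = 4.
  have Ju : uniq [:: g; v; z1; z2].
    by rewrite /= !inE !negb_or z12 eq_sym vg eq_sym z1g eq_sym z2g
               eq_sym z1v eq_sym z2v.
  rewrite -[4]/(size [:: g; v; z1; z2]) -(card_uniqP Ju).
  by apply: eq_card => x; rewrite !inE !orbA.
have D3 : #|D| <= 3.
  have D1 w x : x \in S -> adj x w -> #|N w| = 2 -> #|N w :\ x| = 1.
    by move=> xS xw w2; rewrite card_setD1 ?w2 // N_in xS adj_sym.
  have [le1 _] := leq_card_setU (N v :\ f) (N z1 :\ u1).
  have [le2 _] := leq_card_setU (N v :\ f :|: (N z1 :\ u1)) (N z2 :\ u2).
  move: le1 le2; rewrite (D1 v) ?I_deg2 // (D1 z1) ?H_sub // (D1 z2) ?H_sub //.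
  by rewrite /D; clear; lia.
pose B := J :|: [set f; u1; u2] :|: D.
have : #|B| <= 10.
  have [le1 _] := leq_card_setU J [set f; u1; u2].
  have [le2 _] := leq_card_setU (J :|: [set f; u1; u2]) D.
  by have := card_le3 f u1 u2; rewrite /B; move: D3 le1 le2; rewrite J4; clear; lia.
suff : 5 * #|J| < 2 * #|B| by rewrite J4; clear; lia.
have inJ x : x \in J -> [\/ x = g, x = v, x = z1 | x = z2].
  rewrite !inE -!orbA => /or4P[] /eqP->;
  by [constructor 1 | constructor 2 | constructor 3 | constructor 4].
apply: reduce_bound.
- by apply/subsetP => x /inJ[]->.
- apply/independentP => x y /inJ[]-> /inJ[]-> //;
    by rewrite ?adj_irr // adj_sym.
- by apply/set0Pn; exists g; rewrite !inE eqxx.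
- by rewrite /B -setUA subsetUl.
- have D_in w c : w \in N c -> N c :\ w \subset D -> w \in B -> N c \subset B.
    move=> wN sub wB; apply/subsetP => x xN.
    have [->//|xw] := eqVneq x w.
    by rewrite /B in_setU (subsetP sub) ?orbT // in_setD1 xw.
  move=> x /inJ[]->.
  + apply/subsetP => y yN; have [->|yf] := eqVneq y f; first by rewrite !inE eqxx !orbT.
    have : y \in N g :\ f by rewrite in_setD1 yf.
    by rewrite EU => /set2P[]->; rewrite !inE eqxx !orbT.
  + apply: (D_in f); first by rewrite N_in fS adj_sym.
      by rewrite /D -setUA subsetUl.
    by rewrite !inE eqxx !orbT.
  + apply: (D_in u1); first by rewrite N_in (H_sub u1H) adj_sym.
      by rewrite /D setUAC subsetUr.
    by rewrite !inE eqxx !orbT.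
  + apply: (D_in u2); first by rewrite N_in (H_sub u2H) adj_sym.
      by rewrite /D subsetUr.
    by rewrite !inE eqxx !orbT.
Qed.

(** Now every [u] in [H] has degree 3 and a single neighbour [z u] in [I]. For the two neighbours
    [x], [y] of some [v] in [I], the set to reduce consists of [x], [y] and the [z u] for their
    other neighbours [u]. *)
Lemma irreducible_set0 : S = set0.
Proof.
apply/eqP/contraT => /set0Pn[f0 f0S].
have [x xH] : exists x, x \in H.
  have /orP[fI|fH] := H_or_I f0S; last by exists f0.
  have [g gN] : exists g, g \in N f0 by apply/card_gt0P; rewrite I_deg2.
  by exists g; apply: nbr_I_sub gN.
have H3 u : u \in H -> #|N u| = 3.
  by move=> uH; apply/(card_nbr_H uH)/eqP/(H_deg2_false uH).
have NI1 u : u \in H -> #|NI u| = 1.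
  move=> uH; have [_ <- _ _] := degree_structure uH; rewrite -[LHS]addn0; congr addn.
  apply/esym/eq_card0 => g; apply/negP; rewrite in_set => /and3P[gH _ /eqP g2].
  exact: H_deg2_false gH g2.
(* The implication makes the choice total; outside [H] the value is arbitrary. *)
have zP u : exists z, (u \in H) ==> (NI u == [set z]).
  have [uH|] := boolP (u \in H); last by exists u.
  by have /eqP/cards1P[z ->] := NI1 _ uH; exists z; rewrite eqxx.
pose z u := xchoose (zP u).
have NIz u : u \in H -> NI u = [set z u].
  by move=> uH; apply/eqP/(implyP (xchooseP (zP u))).
have zI u : u \in H -> z u \in I /\ adj u (z u).
  move=> uH; have : z u \in NI u by rewrite NIz // set11.
  by rewrite inE => /andP[].
have z_eq u w : u \in H -> w \in I -> adj u w -> w = z u.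
  by move=> uH wI uw; apply/set1P; rewrite -NIz // inE wI.
have [vI xv] := zI _ xH; set v := z x in vI xv.
have vS := subsetP I_sub _ vI; have xS := H_sub xH.
have xNv : x \in N v by rewrite N_in xS adj_sym.
have [y ENv] : exists y, N v :\ x = [set y].
  by apply/cards1P; rewrite card_setD1 // I_deg2.
have /setD1P[yx yNv] : y \in N v :\ x by rewrite ENv set11.
have Nv w : w \in N v -> w = x \/ w = y.
  move=> wN; have [->|wx] := eqVneq w x; [by left|right].
  by apply/set1P; rewrite -ENv in_setD1 wx.
have yH := nbr_I_sub vI yNv; have yS := H_sub yH.
have yv : adj y v by rewrite adj_sym; case/nbrP: yNv.
have vzy : v = z y by apply: z_eq.
have nxy : ~~ adj x y by apply: no_triangle xNv yNv; rewrite ?I_deg2.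
pose U := N x :\ v :|: N y :\ v.
have U4 : #|U| <= 4.
  have [le _] := leq_card_setU (N x :\ v) (N y :\ v).
  by apply: leq_trans le _; rewrite !card_setD1 ?H3 // N_in vS.
(* The only neighbour of [x] or [y] in [I] is [v]. If [z u] were [v], then [u] would be [x] or [y],
   but neither of these is adjacent to [x] or [y]. *)
have UP u : u \in U -> [/\ u \in H, z u != v & (u \in N x) || (u \in N y)].
  move=> uU; have [uv uN] : u != v /\ (u \in N x) || (u \in N y).
    by move: uU; rewrite in_setU !in_setD1 => /orP[]/andP[-> ->]; rewrite ?orbT.
  have uH : u \in H.
    have uS : u \in S by case/orP: uN => /nbrP[].
    have /orP[uI|//] := H_or_I uS; case/eqP: uv.
    by case/orP: uN => /nbrP[_ au]; [rewrite [u](z_eq x) | rewrite [u](z_eq y)].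
  split=> //; have [_ uz] := zI _ uH; apply: contraL uN => /eqP zv.
  have /Nv[->|->] : u \in N v by rewrite N_in (H_sub uH) adj_sym -zv.
    by rewrite !N_in negb_or (negPf (adj_irr xS)) adj_sym (negPf nxy) !andbF.
  by rewrite !N_in negb_or (negPf (adj_irr yS)) (negPf nxy) !andbF.
pose Z := z @: U.
have Z4 : #|Z| <= 4 by apply: leq_trans (leq_imset_card _ _) U4.
have ZI w : w \in Z -> [/\ w \in I, ~~ adj x w & ~~ adj y w].
  move=> /imsetP[u /UP[uH zv _] ->]; have [zuI _] := zI _ uH; split=> //.
    by apply: contra zv => xz; apply/eqP/z_eq.
  by apply: contra zv => yz; apply/eqP; rewrite vzy; apply: z_eq.
(* All neighbours of [x] and [y] other than [v] are neighbours of [Z], so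
   |N[J]| <= 3 + 3 |Z| while |J| = 2 + |Z| and |Z| <= 4. *)
pose J := [set x; y] :|: Z.
pose B := [set x; y; v] :|: Z :|: \bigcup_(w in Z) N w.
have cJ : #|J| = 2 + #|Z|.
  have [_ E] := leq_card_setU [set x; y] Z.
  have : [disjoint [set x; y] & Z].
    rewrite disjoints_subset; apply/subsetP => w /set2P wxy; rewrite in_setC.
    apply/negP => /ZI[wI _ _]; case: wxy wI => ->.
      by case/setDP: xH => _ /negbTE->.
    by case/setDP: yH => _ /negbTE->.
  by rewrite -E cards2 (eq_sym x) yx => /eqP.
have cB : #|B| <= 3 + #|Z| + 2 * #|Z|.
  have [le1 _] := leq_card_setU [set x; y; v] Z.
  have [le2 _] := leq_card_setU ([set x; y; v] :|: Z) (\bigcup_(w in Z) N w).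
  have le3 := leq_card_bigcup Z (fun w => N w).
  have E : \sum_(w in Z) #|N w| = 2 * #|Z|.
    rewrite (eq_bigr (fun=> 2)) ?sum_nat_const 1?mulnC // => w /ZI[wI _ _].
    exact: I_deg2.
  by have := card_le3 x y v; rewrite /B; move: le1 le2 le3 E; clear; lia.
have : 5 * #|J| < 2 * #|B|; last by move: cJ cB Z4; clear; lia.
have NU u : u \in U -> u \in B.
  move=> uU; have [uH _ _] := UP _ uU; have [_ uz] := zI _ uH.
  rewrite in_setU; apply/orP; right; apply/bigcupP; exists (z u).
    exact: imset_f.
  by rewrite N_in (H_sub uH) adj_sym.
have vB : v \in B by rewrite !inE eqxx !orbT.
apply: reduce_bound.
- apply/subsetP => w; rewrite in_setU => /orP[/set2P[]->|/ZI[wI _ _]] //.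
  exact: (subsetP I_sub).
- apply/independentP => w w'.
  rewrite !(in_setU _ _ Z) => /orP[/set2P[]->|wZ] /orP[/set2P[]->|w'Z].
  + exact: adj_irr.
  + by [].
  + by case/ZI: w'Z.
  + by rewrite adj_sym.
  + exact: adj_irr.
  + by case/ZI: w'Z.
  + by rewrite adj_sym; case/ZI: wZ.
  + by rewrite adj_sym; case/ZI: wZ.
  + by case/ZI: wZ => wI _ _; case/ZI: w'Z => w'I _ _; apply: I_independent.
- by apply/set0Pn; exists x; rewrite !inE eqxx.
- apply/subsetP => w; rewrite in_setU => /orP[/set2P[]->|wZ].
  + by rewrite !inE eqxx.
  + by rewrite !inE eqxx orbT.
  + by rewrite !in_setU wZ orbT.
- move=> w; rewrite in_setU => /orP[/set2P[]->|wZ]; last first.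
  + apply/subsetP => u uN; rewrite in_setU; apply/orP; right.
    by apply/bigcupP; exists w.
  + apply/subsetP => u uN; have [->//|uv] := eqVneq u v.
    by apply: NU; rewrite in_setU !in_setD1 uv uN orbT.
  + apply/subsetP => u uN; have [->//|uv] := eqVneq u v.
    by apply: NU; rewrite in_setU !in_setD1 uv uN.
Qed.

End Irreducible.

(** * The graph of consecutive edges *)

Section LineGraph.

Variable V : finType.

Definition consecutive : rel (V * V) :=
  fun f g => (f.2 == g.1) || (g.2 == f.1).

Lemma consecutive_sym : symmetric consecutive.
Proof. by move=> f g; rewrite /consecutive orbC. Qed.

Variables (A : {set V}) (S : {set V * V}).
Hypothesis loopless : {in S, forall f, f.1 != f.2}.
(** With [A] fixed, this form of the degree condition passes to every subset of [S], as the
    induction requires. *)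
Hypothesis in_uniq : {in S &, forall f g, f.2 \in A -> f.2 = g.2 -> f = g}.
Hypothesis out_uniq : {in S &, forall f g, f.1 \notin A -> f.1 = g.1 -> f = g}.

Local Notation adj := consecutive.
Local Notation N := (nbr adj S).

Lemma adj_irr f : f \in S -> ~~ adj f f.
Proof. by move=> fS; rewrite /adj orbb eq_sym loopless. Qed.

Definition crossing : {set V * V} :=
  [set f in S | (f.1 \in A) && (f.2 \notin A)].
Local Notation I := crossing.
Local Notation H := (S :\: crossing).

Lemma crossing_independent : {in I &, forall f g, ~~ adj f g}.
Proof.
move=> f g; rewrite !inE => /and3P[_ f1 f2] /and3P[_ g1 g2].
apply/negP => /orP[] /eqP E; first by rewrite E g1 in f2.
by rewrite E f1 in g2.
Qed.

(* An edge with both ends in [A] points to the edge entering its tail, one with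
   both ends outside [A] to the edge leaving its head, and one from outside [A]
   into [A] to none. *)
Definition parent (f : V * V) : {set V * V} :=
  [set g in H | ((f.1 \in A) && (g.2 == f.1)) || ((f.2 \notin A) && (g.1 == f.2))].

(** An edge of [H] does not cross from [A] to its complement, so at most one clause of [parent]
    applies, and it selects at most one edge by [in_uniq] or [out_uniq]. *)
Lemma card_parent f : f \in H -> #|parent f| <= 1.
Proof.
rewrite !inE => /andP[fI fS]; rewrite fS /= in fI.
apply/card_le1_eqP => g h; rewrite !inE.
move=> /andP[/andP[_ gS] gf] /andP[/andP[_ hS] hf].
case/orP: gf hf => /andP[fA /eqP gf].
  rewrite fA /= in fI; move/negPn: fI => fI; rewrite fA fI /= orbF => /eqP hf.
  by apply: in_uniq; rewrite ?gf ?hf.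
rewrite fA andbT in fI; rewrite (negPf fI) fA /= => /eqP hf.
by apply: out_uniq; rewrite ?gf ?hf.
Qed.

(** If the common vertex lies in [A], the edge entering it is a parent of the other edge; otherwise
    the edge leaving it is. *)
Lemma adj_parent f g : f \in H -> g \in H -> adj f g ->
  (g \in parent f) || (f \in parent g).
Proof.
have parE f' g' : g' \in H -> (g' \in parent f') =
    ((f'.1 \in A) && (g'.2 == f'.1)) || ((f'.2 \notin A) && (g'.1 == f'.2)).
  by move=> gH; rewrite [LHS]inE gH.
move=> fH gH; rewrite !parE //.
by case/orP => /eqP E; rewrite E eqxx !andbT;
  [case: (g.1 \in A) | case: (f.1 \in A)]; rewrite ?orbT.
Qed.

Lemma parent_same_side f : f \in H -> #|parent f| = 1 ->
  (f.1 \in A) = (f.2 \in A).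
Proof.
rewrite !inE => /andP[fI fS]; rewrite fS /= in fI.
move: fI; case f1: (f.1 \in A); case f2: (f.2 \in A) => //= _.
suff -> : parent f = set0 by rewrite cards0.
by apply/setP => g; rewrite !inE f1 f2 andbF.
Qed.

(** Of the neighbours of [f], at most one enters its tail and at most one leaves its head. If both
    ends of each are on one side, the former lies within [A] and the latter outside. *)
Lemma nbr_crossing_inj f g h : f \in I -> g \in N f -> h \in N f ->
  (g.1 \in A) = (g.2 \in A) -> (h.1 \in A) = (h.2 \in A) ->
  (g.1 \in A) = (h.1 \in A) -> g = h.
Proof.
rewrite !inE => /and3P[fS f1 f2] /andP[gS fg] /andP[hS fh] gs hs gh.
case/orP: fg => /eqP Eg; case/orP: fh => /eqP Eh.
- by apply: out_uniq => //; rewrite -Eg.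
- by move: gh; rewrite -Eg hs Eh f1 (negPf f2).
- by move: gh; rewrite gs Eg -Eh f1 (negPf f2).
- by apply: in_uniq => //; rewrite Eg.
Qed.

Lemma card_nbr_crossing f : f \in I -> #|N f| <= 2.
Proof.
rewrite !inE => /and3P[fS f1 f2].
have -> : N f = [set g in S | g.2 == f.1] :|: [set g in S | g.1 == f.2].
  by apply/setP => g; rewrite !inE /adj (eq_sym f.2) -andb_orr orbC.
apply: leq_trans (leq_card_setU _ _) _; rewrite -[2]/(1 + 1).
apply: leq_add; apply/card_le1_eqP => g h; rewrite !inE.
- move=> /andP[gS /eqP Eg] /andP[hS /eqP Eh].
  by apply: in_uniq; rewrite ?Eg ?Eh.
- move=> /andP[gS /eqP Eg] /andP[hS /eqP Eh].
  by apply: out_uniq; rewrite -?Eg -?Eh ?Eg ?Eh.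
Qed.

Lemma irreducible_edges : irreducible adj S -> S = set0.
Proof.
move=> irr; apply: (@irreducible_set0 _ adj S I parent (fun f => f.1 \in A)) => //.
- exact: consecutive_sym.
- exact: adj_irr.
- by apply/subsetP => f; rewrite inE => /andP[].
- exact: crossing_independent.
- exact: card_nbr_crossing.
- by move=> f; apply/subsetP => g; rewrite inE => /andP[].
- exact: card_parent.
- by move=> f g fH gH; apply: adj_parent.
- move=> f g fH gH /(parent_same_side fH) f12 /(parent_same_side gH) g12.
  by case/orP => /eqP E; [rewrite f12 E | rewrite g12 E].
- move=> v vI f g fN gN Pf Pg.
  have NH w : w \in N v -> w \in H.
    move=> /nbrP[wS vw]; rewrite in_setD wS andbT; apply: contraL vw => wI.
    exact: crossing_independent.
  apply: (nbr_crossing_inj vI fN gN).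
    exact: parent_same_side (NH _ fN) Pf.
  exact: parent_same_side (NH _ gN) Pg.
Qed.

End LineGraph.

(** * Triangles and the induction on the edge set *)

Definition edge_rel (V : finType) (S : {set V * V}) : rel V :=
  fun x y => (x, y) \in S.

Lemma cycle_sub (V : finType) (S S' : {set V * V}) (s : seq V) :
  S \subset S' -> cycle (edge_rel S) s -> cycle (edge_rel S') s.
Proof. by move/subsetP=> sub; apply: sub_cycle => x y; apply: sub. Qed.

Lemma packing_sub (V : finType) (S S' : {set V * V}) (F : {set 3.-tuple V}) :
  S \subset S' -> triangle_packing (edge_rel S) F ->
  triangle_packing (edge_rel S') F.
Proof.
move=> sub /andP[/forall_inP tri dis]; apply/andP; split=> //.
apply/forall_inP => T /tri /andP[cT uT]; apply/andP; split=> //.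
exact: cycle_sub cT.
Qed.

(** Once [g] follows [f], looplessness forces [h] to run from the head of [g] back to the tail of
    [f]. *)
Lemma adjacent_triangle (V : finType) (S : {set V * V}) (f g h : V * V) :
  {in S, forall f, f.1 != f.2} -> f \in S -> g \in S -> h \in S ->
  consecutive f g -> consecutive f h -> consecutive g h ->
  exists T : 3.-tuple V, directed_triangle (edge_rel [set f; g; h]) T.
Proof.
move=> loopless.
wlog fg : f g / f.2 = g.1 => [th fS gS hS fg fh gh|].
  case/orP: (fg) => /eqP E; first exact: th.
  rewrite [[set f; g]]setUC; apply: th => //.
  by rewrite consecutive_sym.
case: f g h fg => [x y] [y' z] [c d] /= <- xyS yzS cdS _.
have := loopless _ xyS; have := loopless _ yzS; have := loopless _ cdS.
rewrite /consecutive /= => cd yz xy fh gh.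
have [zc dx] : z = c /\ d = x.
  case/orP: fh gh => /eqP E; case/orP => /eqP E'; subst; rewrite ?eqxx // in cd yz xy.
subst; exists [tuple x; y; c]; rewrite /directed_triangle /edge_rel /= !inE !eqxx.
by rewrite ?orbT /= !negb_or xy yz eq_sym cd.
Qed.

(* At a common vertex the two triangles would share the entering or the leaving
   edge. *)
Lemma triangles_disjoint (V : finType) (A : {set V}) (S C : {set V * V})
    (T T' : 3.-tuple V) :
  {in S &, forall f g, f.2 \in A -> f.2 = g.2 -> f = g} ->
  {in S &, forall f g, f.1 \notin A -> f.1 = g.1 -> f = g} ->
  C \subset S -> cycle (edge_rel C) T -> cycle (edge_rel (S :\: C)) T' ->
  [disjoint T & T'].
Proof.
move=> in_uniq out_uniq /subsetP CS cT cT'.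
rewrite disjoint_subset; apply/subsetP => w wT; apply/negP => wT'.
have clash f g : f \in C -> g \in S :\: C -> f <> g.
  by move=> fC /setDP[_ gC] E; rewrite -E fC in gC.
have [wA|wA] := boolP (w \in A).
  have pC := prev_cycle cT wT; have pD := prev_cycle cT' wT'.
  apply: (clash _ _ pC pD); apply: in_uniq => //; first exact: CS.
  by case/setDP: pD.
have nC := next_cycle cT wT; have nD := next_cycle cT' wT'.
apply: (clash _ _ nC nD); apply: out_uniq => //; first exact: CS.
by case/setDP: nD.
Qed.

(** No element outside the closed neighbourhood of [J] is adjacent to [J], and the two estimates add
    up; [c] and [k] are the credits in triangles of the two parts. *)
Lemma independent_extend (T : finType) (adj : rel T) (S J J' : {set T}) (c k : nat) :
  symmetric adj -> J \subset S -> independent adj J ->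
  2 * #|cnbr adj S J| <= 5 * #|J| + c ->
  J' \subset S :\: cnbr adj S J -> independent adj J' ->
  2 * #|S :\: cnbr adj S J| <= 5 * #|J'| + k ->
  [/\ J :|: J' \subset S, independent adj (J :|: J')
    & 2 * #|S| <= 5 * #|J :|: J'| + (c + k)].
Proof.
move=> adj_sym JS /independentP indJ leJ J'C /independentP indJ' leJ'.
have /subsetP J'S := J'C.
have cross f g : f \in J -> g \in J' -> ~~ adj f g.
  move=> fJ /J'S /setDP[gS]; apply: contra => fg.
  by rewrite in_setU; apply/orP; right; apply/bigcupP; exists f => //; apply/nbrP.
split.
- by rewrite subUset JS (subset_trans J'C) ?subsetDl.
- apply/independentP => f g; rewrite !in_setU => /orP[fJ|fJ'] /orP[gJ|gJ'].
  + exact: indJ.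
  + exact: cross.
  + by rewrite adj_sym; apply: cross.
  + exact: indJ'.
have dis : [disjoint J & J'].
  rewrite disjoint_sym disjoint_subset; apply/subsetP => f /J'S /setDP[_].
  by apply: contra => fJ; rewrite in_setU fJ.
have cU : #|J :|: J'| = #|J| + #|J'| by apply/eqP; rewrite (leq_card_setU J J').2.
have cS : #|S| = #|cnbr adj S J| + #|S :\: cnbr adj S J|.
  rewrite -[LHS](cardsID (cnbr adj S J)) (setIidPr _) // subUset JS.
  by apply/bigcupsP => f _; apply/subsetP => g /nbrP[].
by move: leJ leJ' cU cS; clear; lia.
Qed.

Lemma independent_packing (V : finType) (A : {set V}) (S : {set V * V}) :
  {in S, forall f, f.1 != f.2} ->
  {in S &, forall f g, f.2 \in A -> f.2 = g.2 -> f = g} ->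
  {in S &, forall f g, f.1 \notin A -> f.1 = g.1 -> f = g} ->
  exists (J : {set V * V}) (F : {set 3.-tuple V}),
    [/\ J \subset S, independent (@consecutive V) J,
      triangle_packing (edge_rel S) F & 2 * #|S| <= 5 * #|J| + #|F|].
Proof.
have [n] := ubnP #|S|; elim: n S => // n IH S Sn loopless in_uniq out_uniq.
have sym := @consecutive_sym V.
pose adj := @consecutive V.
have irr := adj_irr loopless.
(* [F] uses only edges outside the closed neighbourhood, so that a triangle inside it can still be
   added. *)
have step (J : {set V * V}) c : J \subset S -> independent adj J -> J != set0 ->
  2 * #|cnbr adj S J| <= 5 * #|J| + c ->
  exists (J' : {set V * V}) (F : {set 3.-tuple V}), [/\ J' \subset S,
    independent adj J', triangle_packing (edge_rel (S :\: cnbr adj S J)) F &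
    2 * #|S| <= 5 * #|J'| + (c + #|F|)].
  move=> JS indJ /set0Pn[f fJ] leJ; set C := cnbr adj S J.
  have DS : {subset S :\: C <= S} by move=> g /setDP[].
  have [||||J' [F [J'S indJ' FP le]]] := IH (S :\: C).
  - rewrite ltnS in Sn; apply: leq_trans Sn; apply: proper_card.
    rewrite properE subsetDl; apply/subsetPn; exists f; first exact: (subsetP JS).
    by rewrite in_setD in_setU fJ.
  - exact: sub_in1 loopless.
  - exact: sub_in2 in_uniq.
  - exact: sub_in2 out_uniq.
  have [J''S ind' le'] := independent_extend sym JS indJ leJ J'S indJ' le.
  by exists (J :|: J'), F.
have [S0|/set0Pn[f0 f0S]] := eqVneq S set0.
  exists set0, set0; rewrite S0 !cards0; split=> //.
    by apply/independentP => f; rewrite inE.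
  by apply/andP; split; apply/forall_inP => T; rewrite inE.
have [/existsP[J /and4P[JS indJ J0 le]]|no_red] := boolP [exists J : {set V * V},
    [&& J \subset S, independent adj J, J != set0 & 2 * #|cnbr adj S J| <= 5 * #|J| + 0]].
  have [J' [F [J'S indJ' FP le']]] := step J 0 JS indJ J0 le.
  exists J', F; split=> //.
  exact: packing_sub (subsetDl _ _) FP.
have [/exists_inP[f fS /andP[/eqP f2 /exists_inP[g gN /exists_inP[h hN gh]]]]|no_tri] :=
  boolP [exists f in S, (#|nbr adj S f| == 2) &&
    [exists g in nbr adj S f, exists h in nbr adj S f, adj g h]].
  have [gS fg] := nbrP _ _ _ _ gN; have [hS fh] := nbrP _ _ _ _ hN.
  have [T tT] := adjacent_triangle loopless fS gS hS fg fh gh.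
  have fS1 : [set f] \subset S by rewrite sub1set.
  set C := cnbr adj S [set f].
  have CE : C = f |: nbr adj S f by rewrite /C /cnbr big_set1.
  have C3 : #|C| <= 3.
    have [leC _] := leq_card_setU [set f] (nbr adj S f).
    by rewrite CE; move: leC; rewrite cards1 f2.
  have [|||J' [F [J'S indJ' FP le]]] := step [set f] 1 fS1.
  - by apply/independentP => a b /set1P-> /set1P->; apply: irr.
  - by apply/set0Pn; exists f; rewrite set11.
  (* The three deleted edges cost 6: [f] pays 5, the triangle pays 1. *)
  - by rewrite cards1 -[5 * 1 + 1]/(2 * 3) leq_pmul2l.
  have triC : [set f; g; h] \subset C.
    apply/subsetP => a; rewrite CE !inE -orbA.
    by case/or3P => /eqP->; rewrite ?eqxx // -/(adj _ _) ?gS ?hS ?fg ?fh ?orbT.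
  have CS : C \subset S.
    by rewrite CE subUset fS1; apply/subsetP => a /nbrP[].
  (* The edges of [T] lie in [C], those of [T'] outside [C]. *)
  have disT T' : T' \in F -> [disjoint T & T'].
    move=> T'F; have /andP[/forall_inP/(_ _ T'F)/andP[cT' _] _] := FP.
    apply: (triangles_disjoint in_uniq out_uniq CS _ cT').
    by apply: (cycle_sub triC); case/andP: tT.
  exists J', (T |: F); split=> //.
    apply/andP; split.
      apply/forall_inP => T' /setU1P[->|T'F].
        case/andP: tT => cT uT; rewrite /directed_triangle uT andbT.
        exact: cycle_sub (subset_trans triC CS) cT.
      have /andP[/forall_inP tri _] := packing_sub (subsetDl S C) FP.
      exact: tri.
    have /andP[_ /forall_inP dis] := FP.
    apply/forall_inP => T1 T1F; apply/forall_inP => T2 T2F; apply/implyP => T12.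
    case/setU1P: T1F T12 => [->|T1F] T12; case/setU1P: T2F T12 => [->|T2F] T12.
    - by rewrite eqxx in T12.
    - exact: disT.
    - by rewrite disjoint_sym; apply: disT.
    - by have /forall_inP/(_ _ T2F)/implyP/(_ T12) := dis _ T1F.
  have TF : T \notin F.
    apply/negP => /disT; rewrite disjoint_has => /hasPn /(_ (tnth T ord0)).
    by rewrite mem_tnth => /(_ isT).
  by rewrite cardsU1 TF.
suff S0 : S = set0 by rewrite S0 inE in f0S.
apply: (irreducible_edges loopless in_uniq out_uniq); split.
  move=> J JS indJ J0; rewrite ltnNge -[5 * _]addn0; apply: contra no_red => le.
  by apply/existsP; exists J; apply/and4P.
move=> f g h fS f2 gN hN; apply: contra no_tri => gh.
apply/exists_inP; exists f => //; rewrite f2 eqxx /=.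
by apply/exists_inP; exists g => //; apply/exists_inP; exists h.
Qed.

(** * From independent edges to a directed cut *)

Local Open Scope ring_scope.

Theorem theorem1 (V : finType) (e : rel V) (m t : nat)
  (loopless : irreflexive e)
  (D11 : in_D 1 1 e)
  (hm : m = #|edges e|)
  (ht : t = max_disjoint_triangles e) :
  exists2 C : {set V * V},
    directed_cut e C & (2 * m%:R - t%:R) / 5 <= #|C|%:R :> rat.
Proof.
pose A := [set v | indeg e v <= 1]%N.
have edgeP f : f \in edges e -> e f.1 f.2 by rewrite inE.
have [|||J [F [JS indJ FP le]]] := @independent_packing V A (edges e).
- by move=> f /edgeP ef; apply: contraTneq ef => ->; rewrite loopless.
- move=> [x y] [x' y'] /edgeP exy /edgeP exy' /=; rewrite inE => /card_le1_eqP in1.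
  move=> yy'; rewrite -yy' /= in exy' *; congr (_, _).
  by apply: in1; rewrite inE.
- move=> [x y] [x' y'] /edgeP exy /edgeP exy' /=; rewrite inE => xA.
  have [/(negP xA)//|/card_le1_eqP out1] := D11 x.
  move=> xx'; rewrite -xx' /= in exy' *; congr (_, _).
  by apply: out1; rewrite inE.
pose X := [set f.1 | f in J].
pose C := [set xy in edges e | (xy.1 \in X) && (xy.2 \in ~: X)].
exists C.
  exists X, (~: X); split=> //; first exact: setUCr.
  by rewrite -setI_eq0 setICr.
(* By independence no head of an edge of [J] is a tail of one, so [J] lies in the cut. *)
have JC : (#|J| <= #|C|)%N.
  apply/subset_leq_card/subsetP => f fJ; rewrite inE (subsetP JS) //= imset_f //=.
  rewrite inE; apply/imsetP => -[g gJ E].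
  by have := independentP _ _ indJ f g fJ gJ; rewrite /consecutive E eqxx.
have Ft : (#|F| <= t)%N.
  rewrite ht; apply: leq_bigmax_cond.
  have eE : edge_rel (edges e) =2 e by move=> x y; rewrite /edge_rel inE.
  case/andP: FP => /forall_inP tri dis; apply/andP; split=> //.
  apply/forall_inP => T /tri; rewrite /directed_triangle.
  by rewrite (eq_cycle eE).
have {}le : (2 * m <= 5 * #|C| + t)%N by move: le JC Ft; rewrite -hm; clear; lia.
rewrite ler_pdivrMr // lerBlDr -!natrM -natrD ler_nat; move: le; clear; lia.
Qed.
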